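(* Let $1\le k\le n$ and let $s_1,\dots,s_m$ be continuous sections of the canonical vector bundle $\gamma_n^k\to G_n^k$ (over the Grassmannian of $k$-dimensional linear subspaces of $\mathbb R^n$) such that for every $L\in G_n^k$ the polytope $P(L)=\operatorname{conv}\{s_1(L),\dots,s_m(L)\}\subseteq L$ has non-empty interior in $L$. Then there exist $L\in G_n^k$ and two disjoint support half-spaces $H_1,H_2\subset L$ of $P(L)$ such that $H_1\cup H_2$ contains at least $n+1$ of the points $s_1(L),\dots,s_m(L)$.
   Context: A section $s$ of $\gamma_n^k$ assigns to each $L\in G_n^k$ a vector $s(L)\in L$. A support half-space of a convex polytope $P\subseteq L$ is a closed half-space of $L$ whose boundary hyperplane is a supporting hyperplane of $P$ and whose interior is disjoint from $P$. *)

(* Defs.v *)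
From HB Require Import structures.
From mathcomp Require Import all_boot all_order all_algebra.
From mathcomp Require Import all_classical all_reals all_analysis.

Set Implicit Arguments.
Unset Strict Implicit.
Unset Printing Implicit Defensive.

Import Order.TTheory GRing.Theory Num.Theory.
Import numFieldNormedType.Exports.

Local Open Scope classical_set_scope.
Local Open Scope ring_scope.

Record grassmannian (R : realType) (n k : nat) := Grassmannian {
  subspace_of :> {vspace 'rV[R]_n};
  dim_subspace_of : \dim subspace_of == k }.

HB.instance Definition _ (R : realType) (n k : nat) :=
  [isSub for @subspace_of R n k].
HB.instance Definition _ (R : realType) (n k : nat) :=
  [Choice of grassmannian R n k by <:].

(* The Stiefel manifold of linearly independent k-frames of R^n, a frame being
   the matrix of its k rows; it carries the subspace topology of 'M_(k, n). *)
Definition frame_rows (R : realType) (n k : nat) (A : 'M[R]_(k, n)) :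
  k.-tuple 'rV[R]_n := [tuple row i A | i < k].

Definition stiefel (R : realType) (n k : nat) : set 'M[R]_(k, n) :=
  [set A | free (frame_rows A)].
Arguments stiefel : clear implicits.

Lemma dim_frame_span (R : realType) (n k : nat) (A : stiefel R n k) :
  \dim <<frame_rows (set_val A)>>%VS == k.
Proof.
rewrite -[X in _ == X](size_tuple (frame_rows (set_val A))).
exact: (set_valP A).
Qed.

Definition frame_span (R : realType) (n k : nat) (A : stiefel R n k) :
  grassmannian R n k := Grassmannian (dim_frame_span A).

(* The topology of the Grassmannian is the quotient (final) topology of the
   map sending a frame to its span. *)
Definition grassmannian_open (R : realType) (n k : nat) :
  set_system (grassmannian R n k) :=
  fun U => open (@frame_span R n k @^-1` U).

Section grassmannian_topology.
Context (R : realType) (n k : nat).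

Lemma grassmannian_openT : @grassmannian_open R n k setT.
Proof. by rewrite /grassmannian_open preimage_setT; exact: openT. Qed.

Lemma grassmannian_openI : setI_closed (@grassmannian_open R n k).
Proof.
by move=> U V oU oV; rewrite /grassmannian_open preimage_setI; exact: openI.
Qed.

Lemma grassmannian_open_bigU (I : Type) (U : I -> set (grassmannian R n k)) :
  (forall i, grassmannian_open (U i)) -> grassmannian_open (\bigcup_i U i).
Proof.
move=> oU; rewrite /grassmannian_open preimage_bigcup.
by apply: bigcup_open => i _; exact: oU.
Qed.

HB.instance Definition _ := @isOpenTopological.Build (grassmannian R n k)
  (@grassmannian_open R n k)
  grassmannian_openT grassmannian_openI grassmannian_open_bigU.

End grassmannian_topology.

(* The total space of the canonical bundle, as a subset of the product of the
   Grassmannian and R^n; coerced to a type, it carries the subspace topology. *)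
Definition canonical_bundle (R : realType) (n k : nat) :
  set (grassmannian R n k * 'rV[R]_n) :=
  [set p | p.2 \in subspace_of p.1].
Arguments canonical_bundle : clear implicits.

Definition bundle_proj (R : realType) (n k : nat)
  (e : canonical_bundle R n k) : grassmannian R n k := (set_val e).1.

Definition bundle_vec (R : realType) (n k : nat)
  (e : canonical_bundle R n k) : 'rV[R]_n := (set_val e).2.

Definition continuous_section (R : realType) (n k : nat)
  (s : grassmannian R n k -> canonical_bundle R n k) : Prop :=
  continuous s /\ forall L, bundle_proj (s L) = L.

Definition conv_hull (R : realType) (n m : nat) (v : 'I_m -> 'rV[R]_n) :
  set 'rV[R]_n :=
  [set x | exists w : 'I_m -> R,
     [/\ forall i, 0 <= w i, \sum_i w i = 1 & x = \sum_i w i *: v i]].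

(* The interior of [A] relative to [L], for [A] contained in [L]: the points
   outside [L] are isolated in [subspace L]. *)
Definition interior_in (R : realType) (n : nat) (L : {vspace 'rV[R]_n})
  (A : set 'rV[R]_n) : set 'rV[R]_n :=
  interior (A : set (subspace [set` L])).

(* Every nonzero linear form on L is the restriction of a linear form on R^n
   that does not vanish identically on L. *)
Definition form_on (R : realType) (n : nat) (L : {vspace 'rV[R]_n})
  (f : {scalar 'rV[R]_n}) : Prop :=
  exists2 v, v \in L & f v != 0.

Definition halfspace (R : realType) (n : nat) (L : {vspace 'rV[R]_n})
  (f : {scalar 'rV[R]_n}) (c : R) : set 'rV[R]_n :=
  [set x | x \in L /\ c <= f x].

Definition opp_halfspace (R : realType) (n : nat) (L : {vspace 'rV[R]_n})
  (f : {scalar 'rV[R]_n}) (c : R) : set 'rV[R]_n :=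
  [set x | x \in L /\ f x <= c].

Definition hyperplane (R : realType) (n : nat) (L : {vspace 'rV[R]_n})
  (f : {scalar 'rV[R]_n}) (c : R) : set 'rV[R]_n :=
  [set x | x \in L /\ f x = c].

Definition supporting_hyperplane (R : realType) (n : nat)
  (L : {vspace 'rV[R]_n}) (P : set 'rV[R]_n)
  (f : {scalar 'rV[R]_n}) (c : R) : Prop :=
  hyperplane L f c `&` P !=set0 /\
  (P `<=` halfspace L f c \/ P `<=` opp_halfspace L f c).

Definition support_halfspace (R : realType) (n : nat)
  (L : {vspace 'rV[R]_n}) (P H : set 'rV[R]_n) : Prop :=
  exists (f : {scalar 'rV[R]_n}) (c : R),
    [/\ form_on L f,
        H = halfspace L f c,
        supporting_hyperplane L P f c &
        interior_in L H `&` P = set0].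

(* Main.v *)
Require Import Defs.
From mathcomp Require Import all_boot all_order all_algebra.
From mathcomp Require Import all_classical all_reals all_analysis.
From mathcomp Require Import zify ring lra.

(* Fix a (k-1)-dimensional subspace V and consider only the k-planes spanned by
   V and a line orthogonal to V.  The pairs (L, u), with L such a k-plane and u
   a unit vector of L, form an (n-1)-dimensional space on which (L, u) |->
   (L, -u) acts freely, and which carries a mod 2 tower of chains c_0, ...,
   c_(n-1), c_0 being a point, where c_j has boundary c_(j-1) + (-1) c_(j-1): first
   rotate the line, keeping u on it, then rotate u towards the vectors of V.
   This is what the Borsuk-Ulam theorem uses of the sphere, and Ky Fan's lemma
   holds for it.

   Label (L, u) by the smaller of the indices of a maximum and of a minimum of
   i |-> <s_i(L), u>, with sign + for a maximum and - for a minimum.  Fan's lemma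
   provides arbitrarily small (n-1)-simplices whose n vertices have labels of
   distinct indices.  At the vertex with the largest label, the other extremum
   has an even larger index, whence n + 1 distinct indices; by compactness they
   are all extremal at one and the same (L, u). *)

Import numFieldNormedType.Exports.

Set Implicit Arguments.
Unset Strict Implicit.
Unset Printing Implicit Defensive.

Import Order.TTheory GRing.Theory Num.Theory.

(** * Mod 2 cochains on ordered simplices *)

(** The mod 2 sum of [phi] over the faces of [s]. Cochains are functions of arbitrary lists, so
    degenerate simplices need no separate treatment. *)
Fixpoint coboundary (T : Type) (phi : seq T -> bool) (s : seq T) : bool :=
  if s is v :: s' then phi s' (+) coboundary (fun r => phi (v :: r)) s' else false.

(** The prism operator: the sum of [phi] over the simplices g v_0, ..., g v_i, h v_i, ..., h v_d
    that triangulate the prism between [g] and [h]. *)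
Fixpoint prism (T U : Type) (g h : T -> U) (phi : seq U -> bool) (s : seq T) : bool :=
  if s is v :: s' then
    phi [:: g v, h v & map h s'] (+) prism g h (fun r => phi (g v :: r)) s'
  else false.

Lemma eq_coboundary (T : eqType) (phi psi : seq T -> bool) (s : seq T) :
  (forall r, subseq r s -> (size r).+1 = size s -> phi r = psi r) ->
  coboundary phi s = coboundary psi s.
Proof.
elim: s phi psi => [//|v s IH] phi psi eqp /=.
rewrite eqp ?subseq_cons //; congr (_ (+) _); apply: IH => r rs sr.
by apply: eqp; rewrite /= ?eqxx // sr.
Qed.

Lemma coboundary0 (T : Type) (s : seq T) : coboundary (fun=> false) s = false.
Proof. by elim: s. Qed.

Lemma coboundaryD (T : Type) (phi psi : seq T -> bool) (s : seq T) :
  coboundary (fun r => phi r (+) psi r) s = coboundary phi s (+) coboundary psi s.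
Proof.
elim: s phi psi => //= v s IH phi psi; rewrite IH.
by rewrite addbACA.
Qed.

Lemma coboundary_map (T U : Type) (g : T -> U) (phi : seq U -> bool) (s : seq T) :
  coboundary (fun r => phi (map g r)) s = coboundary phi (map g s).
Proof. by elim: s phi => //= v s IH phi; rewrite -IH. Qed.

Lemma prismD (T U : Type) (g h : T -> U) (phi psi : seq U -> bool) (s : seq T) :
  prism g h (fun r => phi r (+) psi r) s = prism g h phi s (+) prism g h psi s.
Proof.
by elim: s phi psi => //= v s IH phi psi; rewrite IH addbACA.
Qed.

Lemma eq_prism (T U : eqType) (g h : T -> U) (phi psi : seq U -> bool)
    (s : seq T) :
  (forall r, size r = (size s).+1 ->
     {subset r <= map g s ++ map h s} -> phi r = psi r) ->
  prism g h phi s = prism g h psi s.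
Proof.
elim: s phi psi => //= v s IH phi psi eqp; congr (_ (+) _).
  apply: eqp => [|u]; first by rewrite /= size_map.
  by rewrite !(inE, mem_cat) => /or3P[]->; rewrite ?orbT.
apply: IH => r sr rs; apply: eqp => [|u]; first by rewrite /= sr.
rewrite !(inE, mem_cat) => /orP[->//|/rs].
by rewrite mem_cat => /orP[]->; rewrite ?orbT.
Qed.

Lemma prism_map (T U V : Type) (f : T -> U) (g h : U -> V) (g' h' : T -> V)
    (phi : seq V -> bool) (s : seq T) :
  (forall v, g (f v) = g' v) -> (forall v, h (f v) = h' v) ->
  prism g h phi (map f s) = prism g' h' phi s.
Proof.
move=> eg eh; elim: s phi => //= v s IH phi.
by rewrite IH eg eh -map_comp (eq_map eh).
Qed.

Lemma prism_post (T U V : Type) (f : U -> V) (g h : T -> U)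
    (phi : seq V -> bool) (s : seq T) :
  prism (f \o g) (f \o h) phi s = prism g h (fun r => phi (map f r)) s.
Proof. by elim: s phi => //= v s IH phi; rewrite IH -map_comp. Qed.

(** The chain homotopy identity: walls between consecutive simplices of the prism cancel in pairs,
    the side walls form the prism over the boundary, and only the two ends remain. *)
Lemma prism_coboundary (T U : Type) (g h : T -> U) (phi : seq U -> bool) (s : seq T) :
  prism g h (coboundary phi) s (+) coboundary (prism g h phi) s
  = phi (map h s) (+) phi (map g s).
Proof.
elim: s phi => [|v s IH] phi /=; first by rewrite addbb.
rewrite prismD coboundaryD (coboundary_map h (fun r => phi [:: g v, h v & r])).
have := IH (fun r => phi (g v :: r)).
move: (coboundary (fun r => phi [:: g v, h v & r]) _) (prism g h phi s) => c p /=.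
move: (prism _ _ _ _) (coboundary _ _) => q d.
by case: c p q d => -[] [] [] /=; case: (phi _) (phi _) (phi _) => -[] [].
Qed.

(* Consecutive prisms are run in opposite directions, so that [zigzag] is
   unchanged when the homotopy is traversed backwards. *)
Definition zigzag (T U : Type) (h : nat -> T -> U) (N : nat)
    (phi : seq U -> bool) (s : seq T) : bool :=
  \big[addb/false]_(t < N)
    (if odd t then prism (h t.+1) (h t) phi s else prism (h t) (h t.+1) phi s).

Lemma zigzagD (T U : Type) (h : nat -> T -> U) N (phi psi : seq U -> bool) s :
  zigzag h N (fun r => phi r (+) psi r) s
  = zigzag h N phi s (+) zigzag h N psi s.
Proof.
rewrite /zigzag -big_split; apply: eq_bigr => t _ /=.
by case: ifP; rewrite prismD.
Qed.

Lemma eq_zigzag (T U : eqType) (h : nat -> T -> U) N (phi psi : seq U -> bool)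
    (s : seq T) :
  (forall t r, (t < N)%N -> size r = (size s).+1 ->
     {subset r <= map (h t) s ++ map (h t.+1) s} -> phi r = psi r) ->
  zigzag h N phi s = zigzag h N psi s.
Proof.
move=> eqp; apply: eq_bigr => t _; case: ifP => _; apply: eq_prism => r sr rs.
  apply: (eqp t) => // u /rs.
  by rewrite !mem_cat orbC.
exact: (eqp t).
Qed.

(** Mod 2, a prism run backwards contributes the same two ends, so the sum over the steps
    telescopes. *)
Lemma zigzag_coboundary (T U : Type) (h : nat -> T -> U) N (phi : seq U -> bool) s :
  zigzag h N (coboundary phi) s (+) coboundary (zigzag h N phi) s
  = phi (map (h N) s) (+) phi (map (h 0) s).
Proof.
rewrite /zigzag; elim: N => [|N IH].
  rewrite big_ord0 addbb.
  rewrite (_ : (fun _ => _) = fun=> false) ?coboundary0 //.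
  by apply/funext => r; rewrite big_ord0.
rewrite big_ord_recr /=.
pose p psi r := if odd N then prism (h N.+1) (h N) psi r
  else prism (h N) (h N.+1) psi r.
rewrite -/(p _ s).
rewrite (_ : (fun _ => _) = (fun r => zigzag h N phi r (+) p phi r)); last first.
  by apply/funext => r; rewrite big_ord_recr.
rewrite coboundaryD addbACA /zigzag IH.
have -> : p (coboundary phi) s (+) coboundary (p phi) s = phi (map (h N.+1) s) (+) phi (map (h N) s).
  rewrite /p; case: (odd N); rewrite prism_coboundary //.
  exact: addbC.
by rewrite addbC addbA addbK.
Qed.

(** As [N] is even, the steps t and N - 1 - t have opposite parities, so the prism of step t over
    [map a s] is exactly the prism of step N - 1 - t over [s]. *)
Lemma zigzag_rev (T U : Type) (h : nat -> T -> U) N (a : T -> T)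
    (phi : seq U -> bool) s :
  ~~ odd N -> (forall t v, (t <= N)%N -> h t (a v) = h (N - t)%N v) ->
  zigzag h N phi (map a s) = zigzag h N phi s.
Proof.
move=> evN ha; rewrite /zigzag [RHS](reindex_inj rev_ord_inj) /=.
apply: eq_bigr => t _; have tN := ltn_ord t.
have -> : (N - t.+1).+1 = (N - t)%N by lia.
have -> : odd (N - t.+1) = ~~ odd t by lia.
by case: (odd t) => /=; apply: prism_map => v; rewrite ha // ltnW.
Qed.

Lemma zigzag_equivariant (T U : Type) (h : nat -> T -> U) N (a : T -> T)
    (b : U -> U) (phi : seq U -> bool) s :
  (forall t v, h t (a v) = b (h t v)) ->
  (forall r, phi (map b r) = phi r) ->
  zigzag h N phi (map a s) = zigzag h N phi s.
Proof.
move=> hab phib; apply: eq_bigr => t _.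
have E (i j : nat) : prism (h i) (h j) phi (map a s) = prism (h i) (h j) phi s.
  rewrite (@prism_map _ _ _ _ _ _ (b \o h i) (b \o h j)) // prism_post.
  by congr prism; apply/funext.
by case: ifP => _; apply: E.
Qed.

Lemma zigzag_nil (T U : Type) (h : nat -> T -> U) N (phi : seq U -> bool) :
  zigzag h N phi [::] = false.
Proof. by apply: big1 => t _; case: ifP. Qed.

(** * Sign-alternating labels *)

(* A signed label is encoded by a natural number: its index is the half, its
   sign the parity. *)
Fixpoint alternating (b : bool) (l : seq nat) : bool :=
  if l is x :: t then
    [&& odd x == b, all (fun y => x./2 < y./2)%N t & alternating (~~ b) t]
  else true.

Definition noncomplementary (l : seq nat) : Prop :=
  {in l &, forall x y, x./2 = y./2 -> x = y}.

(** Fan's count of the alternating faces with first sign [b]. A nonempty alternating list has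
    exactly one, missing its last or its first entry according to its own first sign. In any other
    list they come in pairs: such a face misses one of two neighbours of equal sign, and the other
    can be left out instead. *)
Lemma coboundary_alternating (b : bool) (l : seq nat) :
  sorted leq l -> noncomplementary l ->
  coboundary (alternating b) l = alternating b l (+) alternating (~~ b) l.
Proof.
elim: l b => [//|x t IH] b /= xt nc.
have st := path_sorted xt.
have nct : noncomplementary t.
  by move=> y z yt zt; apply: nc; rewrite inE ?yt ?zt orbT.
have xle y : y \in t -> (x <= y)%N.
  by move=> yt; have /allP := order_path_min leq_trans xt; apply.
rewrite negbK; case: (eqVneq (odd x) b) => [xb|xb].
  have -> : (odd x == ~~ b) = false by rewrite xb; case: b {xb}.
  rewrite andFb addbF /=.
  case: t => [|y t] // in xt st IH nc nct xle *.
  have xy : (x <= y)%N by apply: xle; rewrite inE eqxx.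
  have [ltxy|gexy] := ltnP x./2 y./2.
    have all_gt z : z \in y :: t -> (x./2 < z./2)%N.
      rewrite inE => /predU1P[->//|zt]; apply: (leq_trans ltxy).
      apply: half_leq; have /allP := order_path_min leq_trans st; exact.
    have E : coboundary (alternating (~~ b)) (y :: t)
        = coboundary (fun r => all (fun z => x./2 < z./2)%N r && alternating (~~ b) r)
              (y :: t).
      apply: eq_coboundary => r /mem_subseq rs _; rewrite (_ : all _ r) //.
      by apply/allP => z /rs /all_gt.
    have allt : all (fun z => x./2 < z./2)%N t.
      by apply/allP => z zt; apply: all_gt; rewrite inE zt orbT.
    have := IH (~~ b) st nct; rewrite E negbK /= allt ltxy /= => ->.
    by rewrite addbC addbK.
  (* The faces without [x] and without [y] agree; every other face contains [x] twice and is not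
     strictly increasing. *)
  have xyE : x = y.
    apply: nc; rewrite ?inE ?eqxx ?orbT //.
    by apply/eqP; rewrite eqn_leq gexy half_leq.
  subst y; rewrite /= ltnn /= xb eqxx /=.
  by rewrite coboundary0 addbF addbb.
(* Only the face without [x] can begin with the sign [b]. *)
have -> /= : odd x == ~~ b by move: xb; case: (odd x) b => -[].
rewrite coboundary0 addbF andb_idl // => altt.
case: t => [|y t] //= in xt st IH nc nct xle altt *.
have xy : (x <= y)%N by apply: xle; rewrite inE eqxx.
have ltxy : (x./2 < y./2)%N.
  rewrite ltn_neqAle half_leq // andbT; apply: contra xb => /eqP xyE.
  move: altt => /andP[/eqP <- _]; apply/eqP; congr odd.
  by apply: nc; rewrite ?inE ?eqxx ?orbT.
rewrite ltxy /=; move: altt => /and3P[_ /allP yt _].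
by apply/allP => z /yt; apply: ltn_trans.
Qed.

(** The labels are sorted first, since the order of the vertices of a simplex is unrelated to that
    of their labels. *)
Definition fan (b : bool) (l : seq nat) : bool := alternating b (sort leq l).

Lemma perm_fan b l l' : perm_eq l l' -> fan b l = fan b l'.
Proof. by move=> /(perm_sortP leq_total leq_trans anti_leq); rewrite /fan => ->. Qed.

(** [rem] deletes the first occurrence of a repeated entry, which is harmless because [phi] ignores
    the order. This form shows that the coboundary ignores it too. *)
Lemma coboundary_rem (T : eqType) (phi : seq T -> bool) (l : seq T) :
  (forall r r', perm_eq r r' -> phi r = phi r') ->
  coboundary phi l = \big[addb/false]_(x <- l) phi (rem x l).
Proof.
elim: l phi => [|v s IH] phi pphi; first by rewrite big_nil.
rewrite big_cons /= eqxx; congr (_ (+) _).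
rewrite IH; last by move=> r r' rr'; apply: pphi; rewrite perm_cons.
rewrite !big_seq; apply: eq_bigr => x xs /=.
case: eqVneq => [->|//]; apply: pphi.
by rewrite perm_sym perm_to_rem.
Qed.

Lemma coboundary_fan (b : bool) (l : seq nat) : noncomplementary l ->
  coboundary (fan b) l = fan b l (+) fan (~~ b) l.
Proof.
move=> nc.
have plS : perm_eq l (sort leq l) by rewrite perm_sym perm_sort.
have -> : coboundary (fan b) l = coboundary (fan b) (sort leq l).
  rewrite !coboundary_rem; try exact: perm_fan.
  rewrite (perm_big _ plS); apply: eq_bigr => x _; apply: perm_fan.
  have [xl|xl] := boolP (x \in l); last first.
    by rewrite !rem_id // -(perm_mem plS).
  rewrite -(perm_cons x) -(permPl (perm_to_rem xl)) (permPl plS).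
  by apply: perm_to_rem; rewrite -(perm_mem plS).
rewrite /fan -(@coboundary_alternating b (sort leq l)).
- apply: eq_coboundary => r rs _; rewrite sorted_sort //; first exact: leq_trans.
  exact: subseq_sorted leq_trans _ _ rs (sort_sorted leq_total l).
- exact: sort_sorted leq_total l.
- by move=> x y; rewrite !mem_sort; apply: nc.
Qed.

Lemma alternating_uniq b l : alternating b l -> uniq (map half l).
Proof.
elim: l b => //= x t IH b /and3P[_ /allP xt /IH ->]; rewrite andbT.
by apply/mapP => -[y /xt lt_xy E]; rewrite E ltnn in lt_xy.
Qed.

Lemma fan_uniq b l : fan b l -> uniq (map half l).
Proof.
move=> /alternating_uniq; rewrite (perm_uniq (s2 := map half l)) //.
by apply: perm_map; rewrite perm_sort.
Qed.

Local Open Scope classical_set_scope.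
Local Open Scope ring_scope.

Definition opp_label (x : nat) : nat := if odd x then x.-1 else x.+1.

Lemma half_opp_label x : (opp_label x)./2 = x./2.
Proof. by rewrite /opp_label; case: ifP => ox; lia. Qed.

Lemma odd_opp_label x : odd (opp_label x) = ~~ odd x.
Proof. by rewrite /opp_label; case: ifP => ox; lia. Qed.

Lemma opp_labelK : involutive opp_label.
Proof.
move=> x; rewrite {1}/opp_label odd_opp_label /opp_label.
by case ox : (odd x) => /=; lia.
Qed.

Lemma alternating_opp b l :
  alternating b l -> alternating (~~ b) (map opp_label l).
Proof.
elim: l b => //= x t IH b /and3P[/eqP xb xt /IH altt].
rewrite odd_opp_label xb eqxx altt andbT all_map half_opp_label.
by apply: sub_all xt => y /=; rewrite half_opp_label.
Qed.

Lemma alternating_sorted b l : alternating b l -> sorted leq l.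
Proof.
rewrite (sorted_pairwise leq_trans).
elim: l b => //= x t IH b /and3P[_ xt /IH ->]; rewrite andbT.
apply: sub_all xt => y xy; rewrite leqNgt; apply/negP => /ltnW /half_leq.
by rewrite leqNgt xy.
Qed.

Lemma fan_opp b l : fan b (map opp_label l) = fan (~~ b) l.
Proof.
have imp c r : fan c r -> fan (~~ c) (map opp_label r).
  move=> /alternating_opp altr; rewrite /fan.
  have <- // : map opp_label (sort leq r) = sort leq (map opp_label r).
  rewrite -[LHS](sorted_sort leq_trans) ?(alternating_sorted altr) //.
  apply/(perm_sortP leq_total leq_trans anti_leq).
  by apply: perm_map; rewrite perm_sort.
apply/idP/idP => /imp; rewrite ?negbK //.
by rewrite -map_comp (eq_map opp_labelK) map_id.
Qed.

(** * Towers of chains and Fan's lemma *)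

Definition small_simplex (R : realType) (Y : normedModType R) (d : nat)
    (S : set Y) (r : R) (s : seq Y) : Prop :=
  [/\ size s = d.+1, {in s, forall p, S p} &
      {in s &, forall p q, `|p - q| <= r}].

(* [tower d S r C]: the functional [C] is the evaluation of cochains at a mod 2
   chain of dimension [d], made of simplices of diameter at most [r] with
   vertices in [S], whose boundary is [c + alpha c] for a chain [c] of the same
   kind of dimension [d - 1], and so on down to a single point.  Cochains are
   restricted to a class [inv] so that [alpha] may be an involution only up to
   the action of another map. *)
Inductive tower (R : realType) (Y : normedModType R)
    (inv : (seq Y -> bool) -> Prop) (alpha : Y -> Y) :
    nat -> set Y -> R -> ((seq Y -> bool) -> bool) -> Prop :=
| tower_point (y : Y) (S : set Y) (r : R) : S y -> 0 <= r ->
    tower inv alpha 0 S r (fun phi => phi [:: y])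
| tower_step d S r C S' r' C' : tower inv alpha d S r C ->
    S `<=` S' -> r <= r' ->
    (forall phi psi, C' (fun s => phi s (+) psi s) = C' phi (+) C' psi) ->
    (forall phi psi, (forall s, small_simplex d.+1 S' r' s -> phi s = psi s) ->
       C' phi = C' psi) ->
    (forall phi, inv phi ->
       C' (coboundary phi) = C (fun s => phi s (+) phi (map alpha s))) ->
    tower inv alpha d.+1 S' r' C'.

Section tower_theory.
Context (R : realType).

Section one_space.
Context (Y : normedModType R) (inv : (seq Y -> bool) -> Prop) (alpha : Y -> Y).

Lemma tower_add d S r C : tower inv alpha d S r C ->
  forall phi psi, C (fun s => phi s (+) psi s) = C phi (+) C psi.
Proof. by case. Qed.

Lemma eq_tower d S r C : tower inv alpha d S r C -> forall phi psi,
  (forall s, small_simplex d S r s -> phi s = psi s) -> C phi = C psi.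
Proof.
case=> // y {}S {}r Sy r0 phi psi; apply; split=> // [p|p q]; rewrite !inE.
  by move=> /eqP ->.
by move=> /eqP -> /eqP ->; rewrite subrr normr0.
Qed.

Lemma tower_false d S r C : tower inv alpha d S r C -> C (fun=> false) = false.
Proof. by move=> tC; rewrite -[RHS](addbb (C (fun=> false))) -(tower_add tC). Qed.

(** The number of simplices of the chain with alternating labels, of either first sign, is odd. Mod
    2 it is the coboundary of [fan true], hence a count over the boundary c + alpha c; as [alpha]
    negates the labels, this is the same number for c, one dimension lower, and so on down to a
    single point. *)
Lemma fan_tower d S r C (lab : Y -> nat) : tower inv alpha d S r C ->
  (forall b, inv (fun s => fan b (map lab s))) ->
  (forall y, S y -> lab (alpha y) = opp_label (lab y)) ->
  (forall p q, S p -> S q -> `|p - q| <= r ->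
     (lab p)./2 = (lab q)./2 -> lab p = lab q) ->
  exists2 s, small_simplex d S r s & uniq (map (half \o lab) s).
Proof.
move=> tC invf labN nc; pose D b s := fan b (map lab s).
have CD : C (fun s => D true s (+) D false s) = true.
  elim: tC labN nc => [y {}S {}r Sy r0 _ _|{}d {}S {}r {}C S' r' C' tC IH SS' rr'
    add' supp' bd' labN nc].
    by rewrite /D /fan /= !andbT; case: (odd _).
  rewrite -[RHS](IH (fun y Sy => labN y (SS' y Sy))
    (fun p q Sp Sq pq => nc p q (SS' p Sp) (SS' q Sq) (le_trans pq rr'))).
  transitivity (C' (coboundary (D true))).
    apply: supp' => s [_ Ss sr]; rewrite coboundary_map coboundary_fan //.
    move=> _ _ /mapP[p ps ->] /mapP[q qs ->].
    by apply: nc; [exact: Ss|exact: Ss|exact: sr].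
  rewrite bd'; last exact: invf.
  apply: (eq_tower tC) => s [_ Ss _]; congr (_ (+) _).
  rewrite /D -map_comp (_ : map _ s = map opp_label (map lab s)) ?fan_opp //.
  by rewrite -map_comp; apply/eq_in_map => p ps /=; apply/labN/SS'/Ss.
have [s Gs Ds] : exists2 s, small_simplex d S r s & D true s (+) D false s.
  apply: contrapT => H; suff : C (fun s => D true s (+) D false s) = false.
    by rewrite CD.
  rewrite -[RHS](tower_false tC); apply: (eq_tower tC) => s Gs.
  by apply/negbTE/negP => Ds; apply: H; exists s.
exists s => //; rewrite map_comp.
by case: (boolP (D true s)) Ds => [/fan_uniq//|_ /fan_uniq].
Qed.

(** The boundary of the chain is c + alpha c, on which an invariant cochain sums to 0. In dimension
    0 the only face is the empty list. *)
Lemma tower_coboundary_invariant d S r C psi : tower inv alpha d S r C ->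
  inv psi -> psi [::] = false -> (forall s, psi (map alpha s) = psi s) ->
  C (coboundary psi) = false.
Proof.
case=> [y {}S {}r _ _|{}d {}S {}r {}C S' r' C' tC _ _ _ _ bd'] invp p0 pa.
  by rewrite /= p0.
rewrite bd' // -[RHS](tower_false tC); congr C; apply/funext => s.
by rewrite pa addbb.
Qed.

(** Drags the chain c of [C] along a homotopy from the identity to [alpha]. The result has boundary
    c + alpha c plus the homotopy over the boundary of c; the latter vanishes because time reversal
    makes [zigzag] invariant under [alpha]. A prism involves two consecutive stages, hence the
    diameter r + eta. *)
Lemma tower_zigzag d S r C (h : nat -> Y -> Y) N S' (eta : R) :
  tower inv alpha d S r C -> ~~ odd N ->
  (forall y, h 0%N y = y) -> (forall y, h N y = alpha y) ->
  (forall t y, (t <= N)%N -> h t (alpha y) = h (N - t)%N y) ->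
  (forall phi, inv phi -> inv (zigzag h N phi)) ->
  S `<=` S' -> 0 <= eta ->
  (forall t y, (t <= N)%N -> S y -> S' (h t y)) ->
  (forall t p q, (t <= N)%N -> `|h t p - h t q| <= `|p - q|) ->
  (forall t p, (t < N)%N -> S p -> `|h t p - h t.+1 p| <= eta) ->
  tower inv alpha d.+1 S' (r + eta) (fun phi => C (zigzag h N phi)).
Proof.
move=> tC evN h0 hN hrev hinv SS' eta0 hS hlip hstep.
apply: (tower_step tC) => //.
- by rewrite lerDl.
- move=> phi psi; rewrite -(tower_add tC); congr C.
  by apply/funext => s; rewrite zigzagD.
- move=> phi psi eqp; apply: (eq_tower tC) => s [sd Ss sr].
  apply: eq_zigzag => t u tN; rewrite sd => ud us; apply: eqp; split=> //.
    move=> p /us; rewrite mem_cat => /orP[] /mapP[q qs ->];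
      by apply: hS; [lia|exact: Ss].
  have dst i j p q : p \in s -> q \in s -> (i <= N)%N -> (j <= N)%N ->
      i = j \/ j = i.+1 \/ i = j.+1 -> `|h i p - h j q| <= r + eta.
    move=> ps qs iN jN ij.
    rewrite -(subrKA (h i q)); apply: (le_trans (ler_normD _ _)).
    apply: lerD; first exact: le_trans (hlip _ _ _ iN) (sr _ _ ps qs).
    case: ij => [->|[ij|ij]]; first by rewrite subrr normr0.
      by rewrite ij in jN *; apply: hstep; [lia|exact: Ss].
    by rewrite ij in iN *; rewrite distrC; apply: hstep; [lia|exact: Ss].
  by move=> p q /us + /us; rewrite !mem_cat => /orP[] /mapP[p' ps ->] /orP[]
    /mapP[q' qs ->]; apply: dst => //; lia.
- move=> phi invphi.
  have -> : C (zigzag h N (coboundary phi))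
      = C (coboundary (zigzag h N phi)) (+) C (fun s => phi s (+) phi (map alpha s)).
    rewrite -(tower_add tC); congr C; apply/funext => s.
    have := zigzag_coboundary h N phi s.
    rewrite (eq_map h0) map_id (eq_map hN) => /(canRL (addbK _)) ->.
    by rewrite addbC [phi s (+) _]addbC.
  rewrite (tower_coboundary_invariant tC) ?zigzag_nil //; first exact: hinv.
  by move=> s; rewrite zigzag_rev.
Qed.

End one_space.

(** [iota] need not carry [alpha] to [beta]: it suffices that admissible cochains do not see the
    difference. This lets x -> -x on a sphere become w -> -w on the pairs (x, w). *)
Lemma tower_push (Y Z : normedModType R) (inv : (seq Z -> bool) -> Prop)
    (alpha : Y -> Y) (beta : Z -> Z) (iota : Y -> Z) (T : set Z) d S r C :
  (forall phi s, inv phi ->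
     phi (map iota (map alpha s)) = phi (map beta (map iota s))) ->
  (forall p q, `|iota p - iota q| <= `|p - q|) ->
  (forall y, S y -> T (iota y)) ->
  tower (fun=> True) alpha d S r C ->
  tower inv beta d T r (fun phi => C (fun s => phi (map iota s))).
Proof.
move=> invP lip ST tC.
elim: tC ST => [y {}S {}r Sy r0|{}d {}S {}r {}C S' r' C' tC IH SS' rr' add' supp' bd'] ST.
  exact: (tower_point _ _ (ST _ Sy) r0).
apply: (tower_step (IH (fun y Sy => ST _ (SS' _ Sy)))) => //.
- move=> phi psi eqp; apply: supp' => s [sd Ss sr]; apply: eqp; split.
  + by rewrite size_map.
  + by move=> _ /mapP[p ps ->]; apply/ST/Ss.
  + move=> _ _ /mapP[p ps ->] /mapP[q qs ->].
    exact: le_trans (lip _ _) (sr _ _ ps qs).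
- move=> phi invphi.
  under eq_fun do rewrite -coboundary_map.
  rewrite bd' //; congr C; apply/funext => s.
  by rewrite invP.
Qed.

End tower_theory.

(** * The tower of chains on the pairs (x, w) *)

Section sweep.
Context (R : realType) (d : nat).
Implicit Types (x e : 'rV[R]_d.+1) (t : nat).

(* With the l^1 norm, the broken line from x through a new basis vector to -x
   ([sweep] below) stays on the unit sphere. *)
Definition l1_sphere (i : nat) : set 'rV[R]_d.+1 :=
  [set x | \sum_j `|x 0 j| = 1 /\ forall j : 'I_d.+1, (i < j)%N -> x 0 j = 0].

Lemma l1_sphere_norm i x : l1_sphere i x -> `|x| <= 1.
Proof.
move=> [x1 _]; rewrite [leLHS]/Num.norm /= mx_normrE; apply/bigmax_leP.
split=> // -[i0 j] _ /=; rewrite (ord1 i0) -x1 (bigD1 j) //= lerDl.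
by apply: sumr_ge0.
Qed.

Lemma l1_sphereS i j : (i <= j)%N -> l1_sphere i `<=` l1_sphere j.
Proof. by move=> ij x [x1 x0]; split=> // l jl; apply: x0; lia. Qed.

Lemma l1_sphere_basis (j : 'I_d.+1) : l1_sphere j (delta_mx 0 j).
Proof.
split=> [|l jl]; last by rewrite mxE eqxx -val_eqE; case: eqP jl => // ->; rewrite ltnn.
rewrite (bigD1 j) //= big1 => [|l lj]; rewrite !mxE ?eqxx ?normr1 ?addr0 //.
by rewrite (negbTE lj) normr0.
Qed.

Context (M : nat) (M0 : (0 < M)%N).

Definition sweep_coef t : R := 1 - t%:R / M%:R.

Definition sweep e t x : 'rV[R]_d.+1 :=
  sweep_coef t *: x + (1 - `|sweep_coef t|) *: e.

Lemma sweep_coef_le1 t : (t <= M.*2)%N -> `|sweep_coef t| <= 1.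
Proof.
move=> tM; have M0' : 0 < M%:R :> R by rewrite ltr0n.
have : t%:R / M%:R <= 2 :> R.
  by rewrite ler_pdivrMr // -natrM ler_nat mul2n.
have : 0 <= t%:R / M%:R :> R by rewrite divr_ge0.
by rewrite /sweep_coef ler_norml; lra.
Qed.

Lemma sweep_coefN t : (t <= M.*2)%N -> sweep_coef (M.*2 - t) = - sweep_coef t.
Proof.
move=> tM; have M0' : M%:R != 0 :> R by rewrite pnatr_eq0 -lt0n.
by rewrite /sweep_coef natrB // -mul2n natrM; field.
Qed.

Lemma sweep0 e x : sweep e 0 x = x.
Proof. by rewrite /sweep /sweep_coef mul0r subr0 scale1r normr1 subrr scale0r addr0. Qed.

Lemma sweepN e t x : (t <= M.*2)%N -> sweep e t (- x) = sweep e (M.*2 - t) x.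
Proof. by move=> tM; rewrite /sweep sweep_coefN // normrN scalerN scaleNr. Qed.

Lemma sweep_end e x : sweep e M.*2 x = - x.
Proof. by rewrite -[in LHS](opprK x) sweepN // subnn sweep0. Qed.

Lemma sweep_lip e t x y : (t <= M.*2)%N -> `|sweep e t x - sweep e t y| <= `|x - y|.
Proof.
move=> tM; rewrite /sweep opprD addrACA subrr addr0 -scalerBr normrZ.
by rewrite ler_piMl // sweep_coef_le1.
Qed.

Lemma sweep_step e t x : `|e| <= 1 -> `|x| <= 1 ->
  `|sweep e t x - sweep e t.+1 x| <= 2 / M%:R.
Proof.
move=> e1 x1; rewrite /sweep opprD addrACA -!scalerBl.
have cE : `|sweep_coef t - sweep_coef t.+1| = M%:R^-1.
  rewrite /sweep_coef -[t.+1]addn1 natrD mulrDl mul1r.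
  rewrite (_ : _ - _ = M%:R^-1); last by ring.
  by rewrite ger0_norm // invr_ge0.
apply: (le_trans (ler_normD _ _)); rewrite !normrZ.
rewrite (_ : 2 / _ = M%:R^-1 + M%:R^-1); last by ring.
apply: lerD.
  by rewrite cE ler_piMr // invr_ge0.
apply: (@le_trans _ _ `|1 - `|sweep_coef t| - (1 - `|sweep_coef t.+1|)|).
  by rewrite ler_piMr.
rewrite -cE [leRHS]distrC (_ : _ - _ = `|sweep_coef t.+1| - `|sweep_coef t|); last by ring.
exact: ler_dist_dist.
Qed.

(** The new coordinate vanishes on [x], so the l^1 norms of the two summands add up to |c| + (1 -
    |c|), with c = [sweep_coef t]. *)
Lemma sweep_sphere i t x (j : 'I_d.+1) : (t <= M.*2)%N -> j = i.+1 :> nat ->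
  l1_sphere i x -> l1_sphere j (sweep (delta_mx 0 j) t x).
Proof.
move=> tM ji [x1 x0]; have c1 := sweep_coef_le1 tM; split; last first.
  move=> l jl; rewrite !mxE x0 ?mulr0 ?add0r ?eqxx; last by lia.
  by rewrite -val_eqE gtn_eqF ?mulr0.
have xj : x 0 j = 0 by apply: x0; rewrite ji.
rewrite (bigD1 j) //= !mxE xj !eqxx mulr0 add0r mulr1 ger0_norm ?subr_ge0 //.
have -> : \sum_(l < d.+1 | l != j) `|sweep (delta_mx 0 j) t x 0 l| = `|sweep_coef t|.
  rewrite -[RHS]mulr1 -x1 [in RHS](bigD1 j) //= xj normr0 add0r mulr_sumr.
  apply: eq_bigr => l lj; rewrite !mxE (negbTE lj) andbF mulr0 addr0.
  exact: normrM.
by rewrite subrK.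
Qed.

End sweep.

Section product_tower.
Context (R : realType) (a k : nat).
Local Notation U := 'rV[R]_a.+1.
Local Notation W := 'rV[R]_k.+1.

Definition flip0 (w : W) : W := \row_j (if j == 0 then - w 0 j else w 0 j).

(* (x, w) and (-x, flip0 w) stand for the same vector of the same subspace. *)
Definition twist (p : U * W) : U * W := (- p.1, flip0 p.2).

Definition twist_invariant (phi : seq (U * W) -> bool) : Prop :=
  forall s, phi (map twist s) = phi s.

Definition fiber_opp (p : U * W) : U * W := (p.1, - p.2).

Lemma norm_fst_le (p : U * W) : `|p.1| <= `|p|.
Proof. by rewrite [leRHS]/Num.norm /= le_max lexx. Qed.

Lemma norm_snd_le (p : U * W) : `|p.2| <= `|p|.
Proof. by rewrite [leRHS]/Num.norm /= le_max lexx orbT. Qed.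

Lemma norm_pair_le (p : U * W) c : `|p.1| <= c -> `|p.2| <= c -> `|p| <= c.
Proof. by move=> h1 h2; rewrite [leLHS]/Num.norm /= ge_max h1. Qed.

Lemma flip0_basis : flip0 (delta_mx 0 0) = - delta_mx 0 0.
Proof.
apply/rowP => j; rewrite !mxE eqxx /=.
by case: (j == 0); rewrite // oppr0.
Qed.

Lemma flip0_sweep M (j : 'I_k.+1) t w : j != 0 ->
  sweep M (delta_mx 0 j) t (flip0 w) = flip0 (sweep M (delta_mx 0 j) t w).
Proof.
move=> j0; apply/rowP => l; rewrite !mxE eqxx /=.
case: (eqVneq l 0) => // ->; rewrite eq_sym (negbTE j0) !mulr0 !addr0.
by rewrite mulrN.
Qed.

Lemma sphere_tower M i : (0 < M)%N -> (i <= a)%N ->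
  exists C, tower (fun=> True) (@GRing.opp U) i (@l1_sphere R a i)
              (i%:R * (2 / M%:R)) C.
Proof.
move=> M0; elim: i => [_|i IH ia].
  exists (fun phi => phi [:: delta_mx 0 0]); apply: tower_point.
    exact: (l1_sphere_basis _ 0).
  by rewrite mul0r.
have [C tC] := IH (ltnW ia).
pose j : 'I_a.+1 := Ordinal (ia : (i.+1 < a.+1)%N).
have ej : `|delta_mx 0 j : U| <= 1 by apply/l1_sphere_norm/l1_sphere_basis.
have eta0 : 0 <= 2 / M%:R :> R by apply: divr_ge0; exact: ler0n.
exists (fun phi => C (zigzag (sweep M (delta_mx 0 j)) M.*2 phi)).
rewrite -natr1 mulrDl mul1r; apply: (tower_zigzag tC _ _ _ _ _ _ eta0) => //.
- by rewrite odd_double.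
- by move=> y; rewrite sweep0.
- by move=> y; rewrite sweep_end.
- by move=> t y tM; rewrite sweepN.
- exact: l1_sphereS.
- by move=> t y tM; apply: (sweep_sphere M0 tM (erefl i.+1 : j = i.+1 :> nat)).
- by move=> t p q tM; apply: sweep_lip.
- by move=> t p _ Sp; apply: sweep_step => //; apply: l1_sphere_norm Sp.
Qed.

(** Starts from the tower of the sphere of x, with w the first basis vector: there -x amounts to -w
    up to [twist]. The other basis vectors are then used one by one to sweep w. *)
Lemma product_tower M q : (0 < M)%N -> (q <= k)%N ->
  exists C, tower twist_invariant fiber_opp (a + q)
    (@l1_sphere R a a `*` @l1_sphere R k q) ((a + q)%:R * (2 / M%:R)) C.
Proof.
move=> M0; elim: q => [_|q IH qk].
  have [C tC] := sphere_tower M0 (leqnn a).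
  rewrite addn0; exists (fun phi => C (fun s =>
    phi (map (fun x : U => (x, delta_mx 0 0)) s))).
  apply: (tower_push _ _ _ tC).
  - move=> phi s inv; rewrite -inv -!map_comp; congr phi.
    apply: eq_map => x; rewrite /twist /fiber_opp /=.
    by rewrite opprK flip0_basis.
  - move=> x y; apply: norm_pair_le => //=.
    by rewrite subrr normr0.
  - by move=> x Sx; split=> //=; apply: (l1_sphere_basis _ 0).
have [C tC] := IH (ltnW qk).
pose j : 'I_k.+1 := Ordinal (qk : (q.+1 < k.+1)%N).
have ej : `|delta_mx 0 j : W| <= 1 by apply/l1_sphere_norm/l1_sphere_basis.
pose h t (p : U * W) := (p.1, sweep M (delta_mx 0 j) t p.2).
have eta0 : 0 <= 2 / M%:R :> R by apply: divr_ge0; exact: ler0n.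
exists (fun phi => C (zigzag h M.*2 phi)).
rewrite addnS -natr1 mulrDl mul1r; apply: (tower_zigzag tC _ _ _ _ _ _ eta0) => //.
- by rewrite odd_double.
- by move=> [x w]; rewrite /h sweep0.
- by move=> y; rewrite /h sweep_end.
- by move=> t y tM; rewrite /h /= sweepN.
(* The new basis vector is not the first one, so [flip0] fixes it and the sweep commutes with
   [twist]. *)
- move=> phi inv s; apply: (@zigzag_equivariant _ _ _ _ _ twist) => // t [x w].
  by rewrite /h /twist /= flip0_sweep.
- by move=> [x w] [Sx Sw]; split=> //; apply: l1_sphereS Sw.
- move=> t y tM [Sx Sw]; split=> //=.
  exact: (sweep_sphere M0 tM (erefl q.+1 : j = q.+1 :> nat)).
- move=> t p p' tM; apply: norm_pair_le; first exact: (norm_fst_le (p - p')).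
  exact: le_trans (sweep_lip _ _ _ _ _) (norm_snd_le (p - p')).
- move=> t p _ [_ Sp]; apply: norm_pair_le; first by rewrite /= subrr normr0 divr_ge0.
  by apply: sweep_step => //; apply: l1_sphere_norm Sp.
Qed.

End product_tower.

(** * Extremal indices *)

Section extrema.
Context (R : realType) (m : nat).
Implicit Types (g : 'I_m -> R) (i : 'I_m).

Definition is_max g i : bool := [forall j, g j <= g i].

Definition is_min g i : bool := [forall j, g i <= g j].

Lemma is_minN g i : is_min g i = is_max (fun j => - g j) i.
Proof. by apply: eq_forallb => j; rewrite lerN2. Qed.

Lemma max_min_disjoint g i j j' : is_max g i -> is_min g i -> g j = g j'.
Proof.
move=> /forallP gi /forallP ig.
have E l : g l = g i by apply/le_anti; rewrite gi ig.
by rewrite !E.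
Qed.

(* The default value [i0] is never reached: a maximum exists. *)
Definition argmax (i0 : 'I_m) g : 'I_m := odflt i0 [pick i | is_max g i].

Lemma argmaxP i0 g : is_max g (argmax i0 g).
Proof.
rewrite /argmax; case: pickP => //= nomax.
have [i _ gi] := @Order.TotalTheory.arg_maxP _ _ _ i0 xpredT g isT.
by have /forallP[] := negbT (nomax i); move=> j; apply: gi.
Qed.

Variable i0 : 'I_m.

(** Defined through [argmax], so that negating [g] exchanges the two chosen indices exactly, even in
    the presence of ties. *)
Definition argmin g : 'I_m := argmax i0 (fun j => - g j).

Lemma argminP g : is_min g (argmin g).
Proof. by rewrite is_minN; exact: argmaxP. Qed.

Lemma argminN g : argmin (fun j => - g j) = argmax i0 g.
Proof. by rewrite /argmin; congr argmax; apply/funext => j; rewrite opprK. Qed.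

Definition extremal_label g : nat :=
  (minn (argmax i0 g) (argmin g)).*2 + (argmax i0 g < argmin g)%N.

Lemma half_extremal_label g :
  (extremal_label g)./2 = minn (argmax i0 g) (argmin g).
Proof. by rewrite /extremal_label addnC half_bit_double. Qed.

Lemma extremal_labelN g : argmax i0 g != argmin g ->
  extremal_label (fun j => - g j) = opp_label (extremal_label g).
Proof.
rewrite -val_eqE /extremal_label /opp_label argminN -/(argmin g) /= => ne.
rewrite oddD odd_double /= oddb minnC.
by case: (ltngtP (argmax i0 g) (argmin g)) ne => //= _ _; lia.
Qed.

End extrema.

(** A Lebesgue number argument: strict inequalities between the values at [y] persist near [y], so
    indices extremal nearby are extremal at [y], and compactness makes the radius uniform. One [y]
    serves all points within [e] of [x]. *)
Lemma extrema_lebesgue (R : realType) (Y : normedModType R) (K : set Y) (m : nat)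
    (f : 'I_m -> Y -> R) :
  compact K -> (forall i, {within K, continuous f i}) ->
  exists2 e : R, 0 < e & forall x, K x -> exists2 y, K y &
    forall p, K p -> `|x - p| <= e ->
    (forall i, is_max (f ^~ p) i -> is_max (f ^~ y) i) /\
    (forall i, is_min (f ^~ p) i -> is_min (f ^~ y) i).
Proof.
move=> /compact_near_coveringP cK cf.
pose good p y := forall i j, f i y < f j y -> f i p < f j p.
have good_near y : K y -> \forall p \near y, K p -> good p y.
  move=> Ky.
  have G : \forall p \near within K (nbhs y), forall ij : 'I_m * 'I_m,
      f ij.1 y < f ij.2 y -> f ij.1 p < f ij.2 p.
    apply: filter_forall => -[i j] /=.
    have [lt_ij|ge_ij] := ltP (f i y) (f j y); last by apply: nearW.
    have /subspace_continuousP/(_ y Ky) ci := cf i.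
    have /subspace_continuousP/(_ y Ky) cj := cf j.
    have [c /andP[ic cjy]] : exists c, f i y < c < f j y.
      by exists ((f i y + f j y) / 2); rewrite midf_lt //= midf_lt.
    have nci : \forall p \near within K (nbhs y), f i p < c := ci _ (lt_nbhsl ic).
    have ncj : \forall p \near within K (nbhs y), c < f j p := cj _ (lt_nbhsr cjy).
    by apply: filterS2 nci ncj => p pc cp _; apply: lt_trans pc cp.
  by rewrite near_withinE in G; apply: filterS G => p Gp Kp i j; apply: (Gp Kp (i, j)).
have cover x : K x -> \forall x' \near x & e \near 0^'+,
    exists2 y, K y & forall p, K p -> `|x' - p| <= e -> good p y.
  move=> Kx; have /nbhs_ballP[e /= e0 ballG] := good_near x Kx.
  have e20 : 0 < e / 2 by rewrite divr_gt0.
  near=> x' d.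
  have dl : d <= e / 2 by near: d; apply: nbhs_right_le.
  have xx' : ball x (e / 2) x' by near: x'; apply: nbhsx_ballx.
  exists x => // p Kp pd; apply: ballG => //.
  rewrite -ball_normE /= in xx' *.
  rewrite -(subrKA x') (le_lt_trans (ler_normD _ _)) // [ltRHS](splitr e).
  by apply: ltr_leD => //; apply: le_trans dl.
have H := cK _ _ _ (at_right_proper_filter 0) cover.
have [e [/= e0 He]] := filter_ex (filterI (nbhs_right_gt 0) H).
exists e => // x Kx; have [y Ky yP] := He x Kx.
exists y => // p Kp xp; have gpy := yP p Kp xp.
split=> i /forallP ip; apply/forallP => j; rewrite leNgt; apply/negP => /gpy;
  by rewrite ltNge ip.
Unshelve. all: by end_near. Qed.

Lemma continuous_sumr (R : realType) (T : topologicalType) (J : Type)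
    (r : seq J) (g : J -> T -> R) (x : T) :
  (forall j, {for x, continuous (g j)}) ->
  {for x, continuous (fun y => \sum_(j <- r) g j y)}.
Proof.
move=> cg; elim: r => [|j r IH].
  rewrite (_ : (fun _ => _) = fun=> 0); first exact: cst_continuous.
  by apply/funext => y; rewrite big_nil.
rewrite (_ : (fun _ => _) = g j + (fun y => \sum_(l <- r) g l y)).
  exact: continuousD.
by apply/funext => y; rewrite big_cons.
Qed.

Section equivariant_extrema.
Context (R : realType).

Lemma l1_sphere_compact d : compact (@l1_sphere R d d).
Proof.
apply: bounded_closed_compact.
  exists 1; split=> // M M1 x /l1_sphere_norm x1.
  exact: le_trans x1 (ltW M1).
have -> : @l1_sphere R d d = (fun x : 'rV[R]_d.+1 => \sum_j `|x 0 j|) @^-1` [set 1].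
  apply/seteqP; split=> [x []//|x x1]; split=> // j.
  by rewrite ltnNge -ltnS ltn_ord.
apply: preimage_closed; last exact/accessible_closed_set1/hausdorff_accessible/Rhausdorff.
move=> x _; apply: continuous_sumr => j.
apply: (@continuous_comp _ _ _ (fun x : 'rV[R]_d.+1 => x 0 j) Num.norm).
  exact: coord_continuous.
exact: norm_continuous.
Qed.

Lemma seq_argmax (T : eqType) (h : T -> nat) x s :
  exists2 p, p \in x :: s & {in x :: s, forall q, h q <= h p}%N.
Proof.
elim: s x => [|y s IH] x.
  by exists x; rewrite ?inE // => q; rewrite inE => /eqP ->.
have [p ps pmax] := IH y; have [xp|px] := leqP (h x) (h p).
  exists p; first by rewrite inE ps orbT.
  by move=> q; rewrite inE => /predU1P[->|/pmax].
exists x; first by rewrite inE eqxx.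
move=> q; rewrite inE => /predU1P[->//|/pmax qp].
exact: leq_trans qp (ltnW px).
Qed.

Lemma equivariant_extrema (a k m : nat)
    (f : 'I_m -> 'rV[R]_a.+1 * 'rV[R]_k.+1 -> R)
    (K := @l1_sphere R a a `*` @l1_sphere R k k) :
  (forall i, {within K, continuous f i}) ->
  (forall i p, f i (fiber_opp p) = - f i p) ->
  (forall i p, f i (twist p) = f i p) ->
  (forall p, K p -> exists i j, f i p != f j p) ->
  exists2 p, K p & (a + k + 2 <=
    #|[pred i | is_max (f ^~ p) i || is_min (f ^~ p) i]|)%N.
Proof.
move=> cf fN ftw fnc.
have cK : compact K by apply: compact_setX; exact: l1_sphere_compact.
have [e e0 leb] := extrema_lebesgue cK cf.
(* A point of [K] provides an index, the default value of [argmax]. *)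
have /fnc[i0 _] : K (delta_mx 0 ord_max, delta_mx 0 ord_max).
  by split; apply: (l1_sphere_basis _ ord_max).
(* [M] is chosen above (a + k) * 2 / e, so that the simplices of the tower have diameter at most
   [e]. *)
have [M M0 Me] : exists2 M, (0 < M)%N & (a + k)%:R * (2 / M%:R) <= e :> R.
  pose c : R := (a + k)%:R * 2 / e.
  have c0 : 0 <= c by rewrite divr_ge0 ?mulr_ge0 // ltW.
  exists (Num.bound c).+1 => //.
  rewrite mulrA ler_pdivrMr ?ltr0n // [leRHS]mulrC -ler_pdivrMr // -/c.
  by rewrite (le_trans (ltW (archi_boundP c0))) // ler_nat.
have [C tC] := product_tower R a M0 (leqnn k).
pose lab p := extremal_label i0 (f ^~ p).
have disj p i : K p -> is_max (f ^~ p) i -> ~~ is_min (f ^~ p) i.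
  move=> /fnc[j [j' jj']] maxi; apply/negP => mini; move/eqP: jj'; apply.
  exact: (max_min_disjoint _ _ maxi mini).
have ne p : K p -> argmax i0 (f ^~ p) != argmin i0 (f ^~ p).
  move=> Kp; apply/eqP => E; have := disj p _ Kp (argmaxP i0 _).
  by rewrite E argminP.
have [s [ss Ks sr] us] : exists2 s, small_simplex (a + k) K ((a + k)%:R * (2 / M%:R)) s
    & uniq (map (half \o lab) s).
  apply: (fan_tower tC).
  - move=> b s; congr fan; rewrite -map_comp; apply: eq_map => p /=.
    by rewrite /lab; congr extremal_label; apply/funext => i; rewrite ftw.
  - move=> p Kp; rewrite /lab -extremal_labelN ?ne //.
    by congr extremal_label; apply/funext => i; rewrite fN.
  (* Complementary labels at [p] and [q] would make one index a maximum at one point and a minimum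
     at the other, hence both at [y]. *)
  - move=> p q Kp Kq /le_trans/(_ Me) pq.
    have [y Ky yP] := leb p Kp.
    have pp : `|p - p| <= e by rewrite subrr normr0 ltW.
    have [pmax pmin] := yP p Kp pp.
    have [qmax qmin] := yP q Kq pq.
    have {}pmax := pmax _ (argmaxP i0 _); have {}pmin := pmin _ (argminP i0 _).
    have {}qmax := qmax _ (argmaxP i0 _); have {}qmin := qmin _ (argminP i0 _).
    have neq i j : is_max (f ^~ y) i -> is_min (f ^~ y) j -> i != j :> nat.
      move=> imax jmin; apply/eqP => /val_inj ij.
      by move: (disj y i Ky imax); rewrite ij jmin.
    rewrite /lab !half_extremal_label /extremal_label => E; rewrite E.
    congr (_ + nat_of_bool _)%N.
    have := neq _ _ pmax qmin; have := neq _ _ qmax pmin; lia.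
pose small p := if (argmax i0 (f ^~ p) < argmin i0 (f ^~ p))%N
  then argmax i0 (f ^~ p) else argmin i0 (f ^~ p).
pose large p := if (argmax i0 (f ^~ p) < argmin i0 (f ^~ p))%N
  then argmin i0 (f ^~ p) else argmax i0 (f ^~ p).
have smallE p : small p = (lab p)./2 :> nat.
  by rewrite /lab half_extremal_label /small minnE; case: ltnP; lia.
have small_large p : K p -> (small p < large p)%N.
  move=> /ne; rewrite -val_eqE /= /small /large.
  by move: (argmax _ _) (argmin _ _) => u v; case: (ltngtP u v).
have [p ps pmax] : exists2 p, p \in s & {in s, forall q, small q <= small p}%N.
  case: s ss {Ks sr us} => // p s _; apply: seq_argmax.
have [y Ky yP] := leb p (Ks p ps).
(* The small indices are distinct, and the large index at [p] exceeds them all. All are extremal at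
   the same [y], every vertex being within [e] of [p]. *)
exists y => //; pose L := large p :: map small s.
have uL : uniq L.
  rewrite /= -(map_inj_uniq val_inj) -map_comp (eq_map smallE) us andbT.
  apply/mapP => -[q qs E]; have := small_large p (Ks p ps).
  by rewrite E ltnNge pmax.
have sizeL : size L = (a + k + 2)%N by rewrite /= size_map ss addn2.
rewrite -sizeL -(card_uniqP uL); apply/subset_leq_card/fintype.subsetP => i.
rewrite !inE => /predU1P iL.
have [q qs qi] : exists2 q, q \in s & i = small q \/ i = large q.
  case: iL => [->|/mapP[q qs ->]]; first by exists p => //; right.
  by exists q => //; left.
have [qmax qmin] := yP q (Ks q qs) (le_trans (sr p q ps qs) Me).
have := qmax _ (argmaxP i0 _); have := qmin _ (argminP i0 _).
by case: qi => ->; rewrite /small /large; case: ifP => _ ymin ymax;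
  rewrite ?ymin ?ymax ?orbT.
Qed.

End equivariant_extrema.

(** * Polytopes and subspaces *)

Section support.
Context (R : realType) (n : nat).
Implicit Types (u v y : 'rV[R]_n) (L : {vspace 'rV[R]_n}) (A : set 'rV[R]_n).

(** The scalar product with [u], written as a composite of linear maps so that its linearity is
    inferred. *)
Definition dot u : {scalar 'rV[R]_n} := (@mxtrace R 1 \o mulmxr u^T)%FUN.
Arguments dot : simpl never.

Lemma dotE u v : dot u v = \sum_j v 0 j * u 0 j.
Proof.
rewrite /dot /= /mxtrace big_ord1 mxE.
by apply: eq_bigr => j _; rewrite mxE.
Qed.

Lemma dotN u v : dot (- u) v = - dot u v.
Proof. by rewrite !dotE -sumrN; apply: eq_bigr => j _; rewrite mxE mulrN. Qed.

Lemma dot_gt0 u : u != 0 -> 0 < dot u u.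
Proof.
move=> u0; rewrite lt_neqAle dotE sumr_ge0 ?andbT => [|j _]; last first.
  by rewrite -expr2 sqr_ge0.
apply: contra u0; rewrite eq_sym psumr_eq0 => [/allP uu|j _]; last first.
  by rewrite -expr2 sqr_ge0.
apply/eqP/rowP => j; rewrite mxE; apply/eqP.
by have := uu j (mem_index_enum j); rewrite mulf_eq0 orbb.
Qed.

Lemma interior_in_perturb L A y v : y \in L -> v \in L -> v != 0 ->
  interior_in L A y -> exists2 t : R, 0 < t & A (y + t *: v).
Proof.
move=> yL vL v0; rewrite /interior_in /interior /= /nbhs /= -nbhs_subspace_in // withinE /=.
move=> [V /nbhs_ballP[e /= e0 yV] AV].
exists (e / 2 / `|v|); first by rewrite !divr_gt0 // normr_gt0.
have : (V `&` [set` L]) (y + (e / 2 / `|v|) *: v).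
  split; last by rewrite /= memvD // memvZ.
  apply: yV; rewrite -ball_normE /= opprD addNKr normrN normrZ.
  rewrite ger0_norm ?divr_ge0 // ?divfK ?normr_eq0 //; last by rewrite ltW.
  by rewrite ltr_pdivrMr // ltr_pMr // ltr1n.
by rewrite -AV => -[].
Qed.

Lemma conv_hull_point (m : nat) (p : 'I_m -> 'rV[R]_n) i : conv_hull p (p i).
Proof.
exists (fun j => (j == i)%:R); split=> [j||]; first by rewrite ler0n.
- by rewrite (bigD1 i) //= eqxx big1 ?addr0 // => j /negbTE ->.
- rewrite (bigD1 i) //= eqxx scale1r big1 ?addr0 // => j /negbTE ->.
  by rewrite scale0r.
Qed.

Lemma conv_hull_le (m : nat) (p : 'I_m -> 'rV[R]_n) (g : {scalar 'rV[R]_n})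
    (c : R) y :
  (forall i, g (p i) <= c) -> conv_hull p y -> g y <= c.
Proof.
move=> gc [w [w0 w1 ->]]; rewrite linear_sum -[c]mul1r -w1 mulr_suml.
by apply: ler_sum => i _; rewrite linearZ /= ler_wpM2l.
Qed.

Lemma conv_hull_mem (m : nat) (p : 'I_m -> 'rV[R]_n) L y :
  (forall i, p i \in L) -> conv_hull p y -> y \in L.
Proof. by move=> pL [w [_ _ ->]]; apply: memv_suml => i _; apply: memvZ. Qed.

(** A point of the polytope in the interior of the half-space could be moved a little along -u
    within the half-space, but its value would then drop below the maximum. *)
Lemma support_halfspace_max (m : nat) (p : 'I_m -> 'rV[R]_n) L u i :
  (forall j, p j \in L) -> u \in L -> u != 0 ->
  (forall j, dot u (p j) <= dot u (p i)) ->
  support_halfspace L (conv_hull p) (halfspace L (dot u) (dot u (p i))).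
Proof.
move=> pL uL u0 imax; exists (dot u), (dot u (p i)); split=> //.
- by exists u => //; rewrite gt_eqF // dot_gt0.
- split; first by exists (p i); split=> //; apply: conv_hull_point.
  right=> y Py; split; first exact: conv_hull_mem Py.
  exact: conv_hull_le Py.
- apply/seteqP; split=> // y [yint Py].
  have yL := conv_hull_mem pL Py.
  have [||t t0 [_]] := interior_in_perturb yL _ _ yint (v := - u).
  + by rewrite memvN.
  + by rewrite oppr_eq0.
  rewrite linearD linearZ linearN /= leNgt => /negP; apply.
  rewrite mulrN ltrBlDr; apply: (le_lt_trans (conv_hull_le imax Py)).
  by rewrite ltrDl mulr_gt0 // dot_gt0.
Qed.

(** Otherwise the form would be constant on the polytope, whereas it increases when an interior
    point moves along [u]. *)
Lemma conv_hull_nonconstant (m : nat) (p : 'I_m -> 'rV[R]_n) L u :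
  (forall j, p j \in L) -> u \in L -> u != 0 ->
  interior_in L (conv_hull p) !=set0 ->
  exists i j, dot u (p i) != dot u (p j).
Proof.
move=> pL uL u0 [y yint].
have Py : conv_hull p y := interior_subset yint.
have yL := conv_hull_mem pL Py.
have [t t0 Pt] := interior_in_perturb yL uL u0 yint.
apply: contrapT => H.
have E i j : dot u (p i) = dot u (p j).
  by apply/eqP/negPn/negP => ne; apply: H; exists i, j.
(* If there are no points at all, any value of [c] will do. *)
have [c pc] : exists c, forall i, dot u (p i) = c.
  have [[i _]|no_i] := pselect (exists i : 'I_m, True).
    by exists (dot u (p i)) => j; apply: E.
  by exists 0 => i; case: no_i; exists i.
have dotc z : conv_hull p z -> dot u z = c.
  move=> [w [_ w1 ->]]; rewrite linear_sum -[RHS]mul1r -w1 mulr_suml.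
  by apply: eq_bigr => i _; rewrite linearZ pc.
have := dotc _ Pt; rewrite linearD linearZ (dotc _ Py) => /eqP.
by rewrite gt_eqF // ltrDl mulr_gt0 // dot_gt0.
Qed.

End support.

(** * The subspaces spanned by a line and fixed coordinate axes *)

Section frames.
Context (R : realType).

Lemma frame_rowsE (n k : nat) (A : 'M[R]_(k, n)) (c : 'I_k -> R) :
  \sum_i c i *: (frame_rows A)`_i = (\row_i c i) *m A.
Proof.
rewrite mulmx_sum_row; apply: eq_bigr => i _.
by rewrite mxE -tnth_nth tnth_mktuple.
Qed.

Lemma mem_frame_span (n k : nat) (A : 'M[R]_(k, n)) (v : 'rV[R]_n) :
  (v \in <<frame_rows A>>%VS) <-> exists c, v = c *m A.
Proof.
split=> [/coord_span ->|[c ->]].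
  by exists (\row_i coord (frame_rows A) i v); rewrite frame_rowsE.
rewrite mulmx_sum_row; apply: memv_suml => i _; apply/memvZ/memv_span.
by rewrite -[row i A](tnth_mktuple (fun i => row i A)) mem_tnth.
Qed.

Lemma continuous_matrix (T : topologicalType) (p q : nat)
    (g : T -> 'M[R]_(p, q)) (x : T) :
  (forall i j, {for x, continuous (fun y => g y i j)}) ->
  {for x, continuous g}.
Proof.
move=> cg U [P Pg PU].
have H : \forall y \near x, forall i j, P i j (g y i j).
  by apply: filter_forall => i; apply: filter_forall => j; apply: cg; apply: Pg.
by apply: filterS H => y Py; apply: PU.
Qed.

Context (a k : nat).
Local Notation U := 'rV[R]_a.+1.
Local Notation W := 'rV[R]_k.+1.

(* The rows of [frame x] span the sum of the line of [x] and of the last [k]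
   coordinate axes. *)
Definition frame (x : U) : 'M[R]_(k.+1, a.+1 + k) :=
  block_mx (x : 'M[R]_(1, a.+1)) 0 0 (1%:M : 'M[R]_k).

Lemma mul_frame (x : U) (v : 'rV[R]_1) (w : 'rV[R]_k) :
  (row_mx v w : W) *m frame x = row_mx (v *m x) w.
Proof.
transitivity (row_mx (v *m x + w *m 0) (v *m 0 + w *m 1%:M)).
  exact: (@mul_row_block _ _ _ _ _ _ v w x 0 0 1%:M).
by rewrite !mulmx0 mulmx1 addr0 add0r.
Qed.

Lemma mul_frame_eq0 (x : U) (w : W) : x != 0 -> w *m frame x = 0 -> w = 0.
Proof.
move=> x0; rewrite -[w](@hsubmxK _ _ 1 k) mul_frame -[0](@row_mx0 _ _ a.+1 k).
move=> /eq_row_mx[lx ->].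
suff -> : lsubmx (w : 'M[R]_(1, 1 + k)) = 0 by rewrite row_mx0.
move: lx; rewrite [lsubmx _]mx11_scalar mul_scalar_mx => /eqP.
by rewrite scaler_eq0 (negbTE x0) orbF => /eqP ->; rewrite raddf0.
Qed.

Lemma frame_free (x : U) : x != 0 -> stiefel R (a.+1 + k) k.+1 (frame x).
Proof.
move=> x0; apply/freeP => c; rewrite frame_rowsE => /(mul_frame_eq0 x0) c0 i.
by move/rowP: c0 => /(_ i); rewrite !mxE.
Qed.

(** The first coordinate of [w] multiplies [x], so the two sign changes cancel; with [line_sumN]
    this justifies [twist]. *)
Lemma flip0_frame (x : U) (w : W) : flip0 w *m frame (- x) = w *m frame x.
Proof.
have flipE v1 v2 : flip0 (row_mx (v1 : 'rV[R]_1) (v2 : 'rV[R]_k) : W)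
    = row_mx (- v1) v2.
  apply/rowP => j; rewrite mxE; case: (@split_ordP 1 k j) => i ->.
    rewrite (_ : _ == 0); last by rewrite [i]ord1.
    apply: etrans (congr1 -%R (row_mxEl v1 v2 0 i)) _.
    by symmetry; apply: etrans (row_mxEl (- v1) v2 0 i) _; rewrite mxE.
  rewrite (_ : _ == 0 = false) //.
  exact: etrans (row_mxEr v1 v2 0 i) (esym (row_mxEr (- v1) v2 0 i)).
rewrite -[w](@hsubmxK _ _ 1 k) flipE !mul_frame.
by rewrite mulNmx mulmxN opprK.
Qed.

(* A dummy nonzero value at 0 makes [line_sum] a total function. *)
Definition nonzero (x : U) : U := if x == 0 then delta_mx 0 0 else x.

Lemma nonzero_neq0 (x : U) : nonzero x != 0.
Proof.
rewrite /nonzero; case: ifPn => // _; apply/eqP => /rowP/(_ 0).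
by rewrite !mxE eqxx => /eqP; rewrite oner_eq0.
Qed.

Definition nonzero_frame (x : U) : stiefel R (a.+1 + k) k.+1 :=
  exist _ (frame (nonzero x)) (mem_set (frame_free (nonzero_neq0 x))).

Definition line_sum (x : U) : grassmannian R (a.+1 + k) k.+1 :=
  frame_span (nonzero_frame x).

Lemma mem_line_sum (x : U) v : x != 0 ->
  (v \in subspace_of (line_sum x)) <-> exists c, v = c *m frame x.
Proof.
by move=> x0; rewrite /= set_valE /= /nonzero (negbTE x0); apply: mem_frame_span.
Qed.

Lemma line_sumN (x : U) : line_sum (- x) = line_sum x.
Proof.
have [->|x0] := eqVneq x 0; first by rewrite oppr0.
have Nx0 : - x != 0 by rewrite oppr_eq0.
apply: val_inj; apply/vspaceP => v; apply/idP/idP.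
  move=> /(mem_line_sum _ Nx0) [c ->]; apply/(mem_line_sum _ x0).
  by exists (flip0 c); rewrite -[in RHS](opprK x) flip0_frame.
move=> /(mem_line_sum _ x0) [c ->]; apply/(mem_line_sum _ Nx0).
by exists (flip0 c); rewrite flip0_frame.
Qed.

Lemma continuous_frame : continuous frame.
Proof.
move=> x; apply: continuous_matrix => i j.
case: (@split_ordP 1 k i) => i' ->; case: (@split_ordP a.+1 k j) => j' ->.
- rewrite (_ : (fun _ => _) = fun y : U => y i' j'); first exact: coord_continuous.
  by apply/funext => y; exact: (block_mxEul (y : 'M[R]_(1, a.+1))).
- rewrite (_ : (fun _ => _) = fun=> 0); first exact: cst_continuous.
  by apply/funext => y; apply: etrans (block_mxEur (y : 'M[R]_(1, a.+1)) 0 0 1%:M i' j') _; rewrite mxE.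
- rewrite (_ : (fun _ => _) = fun=> 0); first exact: cst_continuous.
  by apply/funext => y; apply: etrans (block_mxEdl (y : 'M[R]_(1, a.+1)) 0 0 1%:M i' j') _; rewrite mxE.
- rewrite (_ : (fun _ => _) = fun=> (1%:M : 'M[R]_k) i' j'); first exact: cst_continuous.
  by apply/funext => y; exact: (block_mxEdr (y : 'M[R]_(1, a.+1)) 0 0 1%:M i' j').
Qed.

Lemma frame_span_continuous (n l : nat) : continuous (@frame_span R n l).
Proof. by apply/continuousP => V oV; exact: oV. Qed.

(** Away from 0, [nonzero] is locally the identity, so the map is locally [frame] followed by the
    quotient map [frame_span]. *)
Lemma line_sum_continuous (x : U) : x != 0 -> {for x, continuous line_sum}.
Proof.
move=> x0; apply: (@continuous_comp _ _ _ nonzero_frame); last first.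
  exact: frame_span_continuous.
move=> V [_ /= [[V' oV' <-]]] /= Vx VU.
have near_nz : \forall y \near x, nonzero y = y.
  have : \forall y \near x, y != 0.
    apply/nbhs_ballP; exists `|x|; first by rewrite /= normr_gt0.
    move=> y; rewrite -ball_normE /= => xy; apply: contraTneq xy => ->.
    by rewrite subr0 ltxx.
  by apply: filterS => y /negbTE y0; rewrite /nonzero y0.
have Vfx : nbhs (frame x) V'.
  apply: open_nbhs_nbhs; split=> //.
  by move: Vx; rewrite set_valE /= /nonzero (negbTE x0).
have := continuous_frame Vfx; rewrite nbhs_simpl /= => Vf.
have : \forall y \near x, V (nonzero_frame y).
  apply: filterS2 near_nz Vf => y yE Vy; apply: VU.
  by rewrite /= set_valE /= yE.
by [].
Qed.

End frames.

(** * Sections of the canonical bundle and the two half-spaces *)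

Lemma bundle_vec_mem (R : realType) (n k : nat) (L : grassmannian R n k)
    (e : canonical_bundle R n k) :
  bundle_proj e = L -> bundle_vec e \in subspace_of L.
Proof. by move=> <-; exact: (set_valP e). Qed.

Lemma bundle_vec_continuous (R : realType) (n k : nat) :
  continuous (@bundle_vec R n k).
Proof.
move=> e; apply: (@continuous_comp _ _ _ set_val snd).
  exact: initial_continuous.
by move=> y; exact: cvg_snd.
Qed.

Lemma l1_sphere_neq0 (R : realType) (d i : nat) (x : 'rV[R]_d.+1) :
  l1_sphere i x -> x != 0.
Proof.
move=> [x1 _]; apply/eqP => x0; move: x1; rewrite x0 big1 => [/eqP|j _].
  by rewrite eq_sym oner_eq0.
by rewrite mxE normr0.
Qed.

Lemma two_support_halfspaces (R : realType) (a k m : nat)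
    (s : 'I_m -> grassmannian R (a.+1 + k) k.+1 ->
         canonical_bundle R (a.+1 + k) k.+1)
    (hs : forall i : 'I_m, continuous_section (s i))
    (hP : forall L : grassmannian R (a.+1 + k) k.+1,
      interior_in L (conv_hull (fun i : 'I_m => bundle_vec (s i L))) !=set0) :
  exists (L : grassmannian R (a.+1 + k) k.+1) (H1 H2 : set 'rV[R]_(a.+1 + k)),
    [/\ support_halfspace L (conv_hull (fun i : 'I_m => bundle_vec (s i L))) H1,
        support_halfspace L (conv_hull (fun i : 'I_m => bundle_vec (s i L))) H2,
        H1 `&` H2 = set0 &
        (a.+1 + k + 1 <=
           #|[pred i : 'I_m | bundle_vec (s i L) \in H1 `|` H2]|)%N].
Proof.
pose q i (x : 'rV[R]_a.+1) := bundle_vec (s i (line_sum k x)).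
(* The pair [p] encodes the subspace [line_sum k p.1] and, in it, the direction
   [p.2 *m frame k p.1]. *)
pose f i (p : 'rV[R]_a.+1 * 'rV[R]_k.+1) := dot (p.2 *m frame k p.1) (q i p.1).
have q_cont i x : x != 0 -> {for x, continuous (q i)}.
  move=> x0; apply: (@continuous_comp _ _ _ (line_sum k) (fun L => bundle_vec (s i L))).
    exact: line_sum_continuous.
  apply: (@continuous_comp _ _ _ (s i) (@bundle_vec R _ _)); first by have [cs _] := hs i; exact: cs.
  exact: bundle_vec_continuous.
have fcont i p : p.1 != 0 -> {for p, continuous (f i)}.
  move=> p0; rewrite (_ : f i = fun z => \sum_j
      (q i z.1 0 j * \sum_l z.2 0 l * frame k z.1 l j)); last first.
    by apply/funext => z; rewrite /f dotE; apply: eq_bigr => j _; rewrite mxE.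
  apply: continuous_sumr => j; apply: continuousM.
    apply: (@continuous_comp _ _ _ (fun z => q i z.1)
      (fun v : 'rV[R]_(a.+1 + k) => v 0 j)); last exact: coord_continuous.
    apply: (@continuous_comp _ _ _ fst (q i)); last exact: q_cont.
    by move=> y; exact: cvg_fst.
  apply: continuous_sumr => l; apply: continuousM.
    apply: (@continuous_comp _ _ _ snd (fun v : 'rV[R]_k.+1 => v 0 l)).
      by move=> y; exact: cvg_snd.
    exact: coord_continuous.
  apply: (@continuous_comp _ _ _ (fun z => frame k z.1)
    (fun v : 'M[R]_(k.+1, a.+1 + k) => v l j)); last exact: coord_continuous.
  apply: (@continuous_comp _ _ _ fst (@frame R a k)).
    by move=> y; exact: cvg_fst.
  exact: continuous_frame.
have qL i x : q i x \in subspace_of (line_sum k x).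
  by apply: bundle_vec_mem; have [_] := hs i; apply.
have direction (p : 'rV[R]_a.+1 * 'rV[R]_k.+1) : l1_sphere a p.1 -> l1_sphere k p.2 ->
    p.2 *m frame k p.1 \in subspace_of (line_sum k p.1) /\ p.2 *m frame k p.1 != 0.
  move=> /l1_sphere_neq0 x0 /l1_sphere_neq0 w0; split.
    by apply: (mem_line_sum _ x0).2; exists p.2.
  by apply: contra w0 => /eqP /(mul_frame_eq0 x0) ->.
have [||||[x w] [/= Sx Sw] card_ext] := @equivariant_extrema R a k m f.
- move=> i; apply: continuous_in_subspaceT => p /set_mem[Sp _].
  exact: fcont (l1_sphere_neq0 Sp).
- by move=> i p; rewrite /f [_ *m _]mulNmx dotN.
- by move=> i p; rewrite /f /= flip0_frame /q line_sumN.
- move=> p [Sx Sw]; have [uL u0] := direction p Sx Sw.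
  exact: (conv_hull_nonconstant (fun i => qL i p.1) uL u0 (hP _)).
have [uL u0] := direction (x, w) Sx Sw; move: uL u0 => /=.
set u := w *m frame k x => uL u0.
have [i0 [i1 ne01]] := conv_hull_nonconstant (fun i => qL i x) uL u0 (hP _).
pose g i := dot u (q i x).
pose imax := argmax i0 g; pose imin := argmin i0 g.
have /forallP gmax : is_max g imax by exact: argmaxP.
have /forallP gmin : is_min g imin by exact: argminP.
exists (line_sum k x), (halfspace (line_sum k x) (dot u) (dot u (q imax x))),
  (halfspace (line_sum k x) (dot (- u)) (dot (- u) (q imin x))); split.
- exact: (support_halfspace_max (fun i => qL i x) uL u0 gmax).
- apply: (support_halfspace_max (fun i => qL i x)); rewrite ?memvN ?oppr_eq0 //.
  by move=> j; rewrite !dotN lerN2; exact: gmin.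
(* At a common point [z] the form would be at least the maximum and at most the minimum of [g], so
   that [g] would be constant. *)
- apply/seteqP; split=> // z [[_ zmax] [_]]; rewrite !dotN lerN2 => zmin.
  move: ne01; rewrite (_ : dot u _ = dot u (q i1 x)) ?eqxx //.
  apply: (@max_min_disjoint _ _ g imax); first by apply/forallP.
  by apply/forallP => j; apply: le_trans (le_trans zmax zmin) (gmin j).
- have -> : (a.+1 + k + 1 = a + k + 2)%N by lia.
  apply: (leq_trans card_ext); apply/subset_leq_card/fintype.subsetP => i.
  rewrite !inE => /orP[/forallP imx|/forallP imn]; [left|right].
    by split; [exact: qL|exact: imx].
  by split; [exact: qL|rewrite !dotN lerN2; exact: imn].
Qed.

Unset Implicit Arguments.

Theorem theorem2p10 (R : realType) (n k m : nat) (hk1 : (1 <= k)%N)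
    (hkn : (k <= n)%N)
    (s : 'I_m -> grassmannian R n k -> canonical_bundle R n k)
    (hs : forall i : 'I_m, continuous_section (s i))
    (hP : forall L : grassmannian R n k,
      interior_in L (conv_hull (fun i : 'I_m => bundle_vec (s i L))) !=set0) :
  exists (L : grassmannian R n k) (H1 H2 : set 'rV[R]_n),
    [/\ support_halfspace L (conv_hull (fun i : 'I_m => bundle_vec (s i L))) H1,
        support_halfspace L (conv_hull (fun i : 'I_m => bundle_vec (s i L))) H2,
        H1 `&` H2 = set0 &
        (n + 1 <= #|[pred i : 'I_m | bundle_vec (s i L) \in H1 `|` H2]|)%N].
Proof.
case: k hk1 hkn s hs hP => // k _ hkn.
(* The planes now have dimension k + 1: k coordinate axes span V, and the n - k others, at least
   one, carry the line. *)
have -> : n = ((n - k.+1).+1 + k)%N by lia.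
exact: two_support_halfspaces.
Qed.
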